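(* Suppose that the block diagonal matrix $$\mathrm{diag}(H_{11},H_{22},\dots,H_{nn})+\mathrm{diag}(A_1^\top A_1,A_2^\top A_2,\dots,A_n^\top A_n)$$ is positive definite. Suppose RPADMM (described in the context) is employed to solve the quadratic programming problem $$\min_{x=(x_1,\dots,x_n)\in\mathbb{R}^d}\ \tfrac12x^\top Hx+g^\top x\quad\text{s.t.}\quad\sum_{i=1}^nA_ix_i=b .$$ Then the expected iterative sequence $\{(\mathbb{E}[x^k],\mathbb{E}[\mu^k])\}$ converges to some KKT point of this problem.
   Context: Setting: $x_i\in\mathbb{R}^{d_i}$, $d=d_1+\dots+d_n$, $H\in\mathbb{R}^{d\times d}$ is symmetric positive semidefinite, partitioned into blocks $H_{ij}\in\mathbb{R}^{d_i\times d_j}$; $g\in\mathbb{R}^d$, $A_i\in\mathbb{R}^{m\times d_i}$, $A=[A_1,\dots,A_n]$, $b\in\mathbb{R}^m$. A KKT point is $(\bar x,\bar\mu)\in\mathbb{R}^d\times\mathbb{R}^m$ with $H\bar x+g=A^\top\bar\mu$ and $A\bar x=b$; the set of KKT points is assumed nonempty. RPADMM (randomly permuted ADMM): fix $\beta>0$ and let $$\mathcal L_\beta(x_1,\dots,x_n;\mu)=\tfrac12x^\top Hx+g^\top x-\mu^\top\Big(\sum_{i=1}^nA_ix_i-b\Big)+\tfrac\beta2\Big\|\sum_{i=1}^nA_ix_i-b\Big\|^2 .$$ Start from a deterministic $(x^0,\mu^0)$. At each iteration $k\ge0$, a permutation $\sigma$ of $\{1,\dots,n\}$ is drawn uniformly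 at random, independently of the past. Then, for $j=1,\dots,n$ in order, $x_{\sigma(j)}^{k+1}$ is defined as the minimizer over $x_{\sigma(j)}\in\mathbb{R}^{d_{\sigma(j)}}$ of $\mathcal L_\beta(\cdot\,;\mu^k)$ with blocks $\sigma(1),\dots,\sigma(j-1)$ fixed at their new values $x^{k+1}_{\sigma(1)},\dots,x^{k+1}_{\sigma(j-1)}$ and blocks $\sigma(j+1),\dots,\sigma(n)$ fixed at their old values $x^k_{\sigma(j+1)},\dots,x^k_{\sigma(n)}$. Finally $\mu^{k+1}=\mu^k-\beta\big(\sum_{i=1}^nA_ix_i^{k+1}-b\big)$. The expectation $\mathbb{E}$ is over all random permutations drawn. *)

(* Defs.v *)
From HB Require Import structures.
From mathcomp Require Import all_boot all_order all_fingroup all_algebra.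
From mathcomp Require Import finmap.
From mathcomp Require Import all_classical all_reals all_analysis.
Import numFieldNormedType.Exports.

Set Implicit Arguments.
Unset Strict Implicit.
Unset Printing Implicit Defensive.

Import Order.TTheory GRing.Theory Num.Theory.
Local Open Scope classical_set_scope.
Local Open Scope ring_scope.

(* Euclidean inner product; the library norm `|u| on matrices is the sup norm,
   so squared Euclidean norms are written [dotv u u]. *)
Definition dotv (R : realType) (p : nat) (u v : 'cV[R]_p) : R :=
  (u^T *m v) 0 0.

Definition psdmx (R : realType) (p : nat) (M : 'M[R]_p) : Prop :=
  M^T = M /\ forall u : 'cV[R]_p, 0 <= dotv u (M *m u).

Definition pdmx (R : realType) (p : nat) (M : 'M[R]_p) : Prop :=
  M^T = M /\ forall u : 'cV[R]_p, u != 0 -> 0 < dotv u (M *m u).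

Section QuadraticProgram.
Context (R : realType) (n m : nat) (d : 'I_n -> nat).
Local Notation dim := (\sum_(i < n) d i)%N.
Context (H : 'M[R]_dim) (g : 'cV[R]_dim).
Context (A : forall i : 'I_n, 'M[R]_(m, d i)) (b : 'cV[R]_m).

(* The block x_i of x is [submxcol x i], and H_ij is [submxblock H i j]. *)
Definition residual (x : 'cV[R]_dim) : 'cV[R]_m :=
  \sum_(i < n) A i *m submxcol x i - b.

Definition is_kkt (x : 'cV[R]_dim) (mu : 'cV[R]_m) : Prop :=
  H *m x + g = (\mxrow_i A i)^T *m mu /\ (\mxrow_i A i) *m x = b.

Definition lagrangian (beta : R) (x : 'cV[R]_dim) (mu : 'cV[R]_m) : R :=
  2^-1 * dotv x (H *m x) + dotv g x - dotv mu (residual x)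
  + beta / 2 * dotv (residual x) (residual x).

(* The position of block i in the update order s(0), s(1), ..., s(n-1) is
   s^-1 i: blocks s(0), ..., s(j) are taken from x', the others from x. *)
Definition sweep_point (s : 'S_n) (x x' : 'cV[R]_dim) (j : 'I_n) : 'cV[R]_dim :=
  \mxcol_i (if ((s^-1)%g i <= j)%N then submxcol x' i else submxcol x i).

(* z minimizes f over the i-th block, its other blocks being held fixed. *)
Definition block_minimizer (f : 'cV[R]_dim -> R) (i : 'I_n) (z : 'cV[R]_dim) :
  Prop :=
  forall y : 'cV[R]_dim,
    (forall l : 'I_n, l != i -> submxcol y l = submxcol z l) -> f z <= f y.

Definition admm_step (beta : R) (s : 'S_n) (x : 'cV[R]_dim) (mu : 'cV[R]_m)
    (x' : 'cV[R]_dim) (mu' : 'cV[R]_m) : Prop :=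
  (forall j : 'I_n,
     block_minimizer (fun z => lagrangian beta z mu) (s j)
                     (sweep_point s x x' j)) /\
  mu' = mu - beta *: residual x'.

Definition rpadmm_run (T : Type) (sigma : nat -> T -> 'S_n) (beta : R)
    (x0 : 'cV[R]_dim) (mu0 : 'cV[R]_m)
    (x : nat -> T -> 'cV[R]_dim) (mu : nat -> T -> 'cV[R]_m) : Prop :=
  forall w : T,
    x 0%N w = x0 /\ mu 0%N w = mu0 /\
    forall k : nat,
      admm_step beta (sigma k w) (x k w) (mu k w) (x k.+1 w) (mu k.+1 w).

End QuadraticProgram.

Definition iid_uniform_perms (R : realType) (n : nat) (disp : measure_display)
    (T : measurableType disp) (P : probability T R)
    (sigma : nat -> T -> 'S_n) : Prop :=
  [/\ forall (k : nat) (B : set 'S_n), measurable (sigma k @^-1` B),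
      forall (k : nat) (s : 'S_n),
        P (sigma k @^-1` [set s]) = ((n`!%:R : R)^-1)%:E
    & forall (J : {fset nat}) (B : nat -> set 'S_n),
        P (\bigcap_(k in [set` J]) (sigma k @^-1` B k)) =
        (\prod_(k <- J) P (sigma k @^-1` B k))%E].

(* Entrywise expectation. It is only applied to functions of finitely many of
   the random permutations, which take finitely many values, so all the
   expectations are finite and [fine] loses nothing. *)
Definition expectation_cV (R : realType) (disp : measure_display)
    (T : measurableType disp) (P : probability T R) (p : nat)
    (X : T -> 'cV[R]_p) : 'cV[R]_p :=
  \col_(i < p) fine ('E_P[fun w => X w i (0 : 'I_1)%R])%E.

(* Main.v *)
Require Import Defs.
From HB Require Import structures.
From mathcomp Require Import all_boot all_order all_fingroup all_algebra.
From mathcomp Require Import finmap ring lra.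
From mathcomp Require Import all_classical all_reals all_analysis.
Import numFieldNormedType.Exports.
Set Implicit Arguments.
Unset Strict Implicit.
Unset Printing Implicit Defensive.
Import Order.TTheory GRing.Theory Num.Theory.
Local Open Scope classical_set_scope.
Local Open Scope ring_scope.

(** Write A = [A_1, ..., A_n] and S = H + beta A^T A, and measure errors from a
    KKT point: y = x - xh, nu = mu - muh.  Minimizing the augmented Lagrangian
    over one block is an exact block solve with S, so one sweep in the order t
    sends y to y - K_t (S y - A^T nu), where K_t is the inverse of the block
    lower triangular part of S for the order t ([admm_step_affine],
    [sweepmx]).  The permutation drawn at step k is independent of the state
    reached so far, hence the expected errors follow the deterministic
    recursion

      y' = y - Q (S y - A^T nu),      nu' = nu - beta A y',

    where Q is the average of K_t over all orders ([expectation_cV_next]).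
    Reversing an order transposes K_t, so Q is symmetric; it is positive
    definite because every block solve decreases the energy <w, S w> - 2 <v, w>
    ([sweepmx_energy]).  With W = Q^-1 the recursion is a one-block proximal
    method of multipliers whose proximal matrix W - S may be indefinite.

    Two facts carry the convergence.

    - S Q S < 4/3 S on the vectors that S sees ([sweepsum_bound]).  In the
      semi-inner product of S, 1 - K_t S is a product of orthogonal
      projections, and the bound says that the average of these products over
      all orders is larger than -1/3.  Splitting off one block of the sweep, an
      average for n + 1 blocks is itself an average of operators E Pi, with E an
      average for n blocks and Pi an orthogonal projection; and for E
      self-adjoint, -1/3 < E <= 1 implies <E Pi x, x> > -1/3 <x, x> ([sweep_step_bound]).
      The constant reproduces itself, which makes the induction work.  The
      bound amounts to G := W - 3/4 S > 0 ([pdmx_inv_subr]).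

    - The quadratic form V(y, nu) = <y, W y> - <y, S y> / 2 + |nu|^2 / beta is
      positive definite, and along the recursion it decreases by exactly
      <y + y', S (y + y')> / 4 + <y', H y'> + <y' - y, G (y' - y)>
      ([padmm_lyapunov]).

    So the linear map z -> M z of the recursion does not increase V, and the
    decrease controls M z - z.  For such a map the kernel and the range of
    M - 1 are complementary, and writing z = f + (M - 1) w with M f = f gives
    M^k z = f + (M - 1) M^k w, which tends to f ([iter_mulmx_cvg]).  The fixed
    points of M are the pairs with H y = A^T nu and A y = 0: the limit is a KKT
    point. *)

(** * Quadratic forms *)

Section QuadraticForms.
Context {R : realType} {p : nat}.
Implicit Types (u v w : 'cV[R]_p) (S : 'M[R]_p).

Lemma dotvC u v : dotv u v = dotv v u.
Proof. by rewrite /dotv -[in RHS](trmxK u) -trmx_mul [RHS]mxE. Qed.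

Lemma dotvDr u v w : dotv u (v + w) = dotv u v + dotv u w.
Proof. by rewrite /dotv mulmxDr mxE. Qed.

Lemma dotvZr a u v : dotv u (a *: v) = a * dotv u v.
Proof. by rewrite /dotv -scalemxAr mxE. Qed.

Lemma dotvDl u v w : dotv (u + v) w = dotv u w + dotv v w.
Proof. by rewrite dotvC dotvDr !(dotvC w). Qed.

Lemma dotvZl a u v : dotv (a *: u) v = a * dotv u v.
Proof. by rewrite dotvC dotvZr dotvC. Qed.

Lemma dotvNr u v : dotv u (- v) = - dotv u v.
Proof. by rewrite -scaleN1r dotvZr mulN1r. Qed.

Lemma dotvNl u v : dotv (- u) v = - dotv u v.
Proof. by rewrite dotvC dotvNr dotvC. Qed.

Lemma dotv0 u : dotv u 0 = 0.
Proof. by rewrite /dotv mulmx0 mxE. Qed.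

Lemma dotv0l u : dotv 0 u = 0.
Proof. by rewrite dotvC dotv0. Qed.

Lemma dotv_sumr (I : Type) (r : seq I) (P : pred I) (F : I -> 'cV[R]_p) u :
  dotv u (\sum_(i <- r | P i) F i) = \sum_(i <- r | P i) dotv u (F i).
Proof. by rewrite /dotv mulmx_sumr summxE. Qed.

Lemma dotv_mulmxr q (M : 'M[R]_(p, q)) u (v : 'cV[R]_q) :
  dotv u (M *m v) = dotv (M^T *m u) v.
Proof. by rewrite /dotv trmx_mul trmxK mulmxA. Qed.

Lemma dotvv_ge0 u : 0 <= dotv u u.
Proof.
by rewrite /dotv mxE sumr_ge0// => i _; rewrite mxE -expr2 sqr_ge0.
Qed.

Lemma dotvv_eq0 u : dotv u u = 0 -> u = 0.
Proof.
rewrite /dotv mxE => /eqP; rewrite psumr_eq0; last first.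
  by move=> i _; rewrite mxE -expr2 sqr_ge0.
move=> /allP u0; apply/matrixP => i j; rewrite ord1 mxE.
have := u0 i; rewrite mem_index_enum => /(_ isT) /=.
by rewrite mxE -expr2 sqrf_eq0 => /eqP.
Qed.

Lemma dotv_delta i u : dotv (delta_mx i 0) u = u i 0.
Proof.
by rewrite /dotv trmx_delta -rowE mxE.
Qed.

Definition dotE := (@dotvDl, @dotvDr, @dotvNl, @dotvNr, @dotvZl, @dotvZr).

Lemma form_sym S u v : S^T = S -> dotv u (S *m v) = dotv v (S *m u).
Proof. by move=> ST; rewrite dotv_mulmxr ST dotvC. Qed.

Lemma psdmx_form_ge0 S u : psdmx S -> 0 <= dotv u (S *m u).
Proof. by case. Qed.

Lemma pdmx_psd S : pdmx S -> psdmx S.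
Proof.
move=> [ST Spos]; split=> // u; have [->|/Spos/ltW//] := eqVneq u 0.
by rewrite mulmx0 dotv0.
Qed.

(** The discriminant of the nonnegative polynomial t -> form at u + t v; when
    the form vanishes at v, that polynomial is affine, hence constant. *)
Lemma form_cauchy_schwarz S u v : psdmx S ->
  dotv u (S *m v) ^+ 2 <= dotv u (S *m u) * dotv v (S *m v).
Proof.
move=> Spsd; have ST := Spsd.1.
have pos t : 0 <= dotv u (S *m u) + t * (dotv u (S *m v) *+ 2)
              + t ^+ 2 * dotv v (S *m v).
  have := psdmx_form_ge0 (u + t *: v) Spsd.
  rewrite !(mulmxDr, dotE) -scalemxAr !dotE (form_sym _ _ ST).
  by move=> /le_trans; apply; rewrite le_eqVlt; apply/orP; left; apply/eqP; ring.
have := psdmx_form_ge0 v Spsd; have := psdmx_form_ge0 u Spsd.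
move: (dotv u (S *m u)) (dotv u (S *m v)) (dotv v (S *m v)) pos => a b c pos a0.
rewrite le_eqVlt => /predU1P[c0|c0].
  have [->|b0] := eqVneq b 0; first by rewrite -c0 mulr0 expr0n.
  have := pos (- (a + 1) / (b *+ 2)); rewrite -c0 mulr0 addr0.
  rewrite mulfVK ?mulrn_eq0//; lra.
have := pos (- b / c).
have -> : a + - b / c * (b *+ 2) + (- b / c) ^+ 2 * c = (a * c - b ^+ 2) / c.
  by field; rewrite gt_eqF.
by rewrite pmulr_lge0 ?invr_gt0// subr_ge0.
Qed.

Lemma psdmx_isotropic S u : psdmx S -> dotv u (S *m u) = 0 -> S *m u = 0.
Proof.
move=> Spsd u0; apply: dotvv_eq0; apply/eqP; rewrite -sqrf_eq0 eq_le sqr_ge0.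
by rewrite andbT (le_trans (form_cauchy_schwarz _ u Spsd))// u0 mulr0.
Qed.

Lemma pdmx_unit S : pdmx S -> S \in unitmx.
Proof.
move=> [ST Spos]; rewrite -row_free_unit -kermx_eq0; apply/eqP/row_matrixP => i.
rewrite row0; apply/eqP; rewrite -trmx_eq0; apply: contraT => /Spos.
rewrite -[S in S *m _]ST -trmx_mul (_ : row i (kermx S) *m S = 0) ?trmx0 ?dotv0 ?ltxx//.
by apply/sub_kermxP; exact: row_sub.
Qed.

Lemma pdmx_inv S : pdmx S -> pdmx (invmx S).
Proof.
move=> Spd; have Su := pdmx_unit Spd; case: (Spd) => ST Spos.
split; first by rewrite trmx_inv ST.
move=> u u0; set v := invmx S *m u; have uE : u = S *m v by rewrite mulKVmx.
rewrite uE dotvC; apply: Spos.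
by apply: contra_neq u0 => v0; rewrite uE v0 mulmx0.
Qed.

Lemma pdmx_scalar1 : pdmx (1%:M : 'M[R]_p).
Proof.
split; first by rewrite trmx1.
move=> u u0; rewrite mul1mx lt_def dotvv_ge0 andbT.
by apply: contra_neq u0 => /dotvv_eq0.
Qed.

(** Every linear functional is bounded by the form of a positive definite
    matrix: Cauchy-Schwarz against S^-1 l.  This turns control of a quadratic
    form into control of each coordinate. *)
Lemma pdmx_dotv_bound S l : pdmx S ->
  exists C, 0 <= C /\ forall u, dotv l u ^+ 2 <= C * dotv u (S *m u).
Proof.
move=> Spd; exists (dotv l (invmx S *m l)).
split; first exact/psdmx_form_ge0/pdmx_psd/pdmx_inv.
have Su := pdmx_unit Spd.
move=> u; have := form_cauchy_schwarz (invmx S *m l) u (pdmx_psd Spd).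
by rewrite dotv_mulmxr Spd.1 !mulKVmx// [dotv (invmx S *m l) l]dotvC.
Qed.

End QuadraticForms.

(** * Sweeps of exact block solves *)

Section Sweeps.
Context {R : realType} {p : nat} {I : eqType}.
Context {S : 'M[R]_p} {B : I -> 'M[R]_p}.
(* B i stands for P_i^T (P_i S P_i^T)^-1 P_i, with P_i the projection on block i:
   adding B i (v - S w) to w solves block i of S w = v exactly. *)
Hypothesis S_psd : psdmx S.
Hypothesis B_sym : forall i, (B i)^T = B i.
Hypothesis B_idem : forall i, B i *m S *m B i = B i.
Implicit Types (s t : seq I) (u v x : 'cV[R]_p).

(** The result of sweeping from 0 for the equation S w = v, the head of t being
    the first block that is solved: [sweepmx t *m v].  When t lists every
    block once, this is the inverse of the block lower triangular part of S for
    that order; and 1 - [sweepmx t] S is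
    the product of the projections 1 - B i S. *)
Fixpoint sweepmx t : 'M[R]_p :=
  if t is i :: t' then B i + sweepmx t' *m (1%:M - S *m B i) else 0.

Lemma sweepmx_rcons t i :
  sweepmx (rcons t i) = B i + (1%:M - B i *m S) *m sweepmx t.
Proof.
elim: t => [|j t IH] /=; first by rewrite mul0mx mulmx0.
rewrite IH !(mulmxDl, mulmxDr, mulmxN, mulNmx, mulmx1, mul1mx, mulmxA).
rewrite -!addrA [RHS]addrCA; congr (_ + (_ + _)).
by rewrite addrCA; congr (_ + _); rewrite addrCA.
Qed.

Lemma sweepmx_rcons_mul t i v :
  sweepmx (rcons t i) *m v =
  sweepmx t *m v + B i *m (v - S *m (sweepmx t *m v)).
Proof.
rewrite sweepmx_rcons [LHS]mulmxDl -mulmxA mulmxBl mul1mx -mulmxA mulmxBr.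
by rewrite addrC -addrA [X in _ + X]addrC.
Qed.

(** Transposing turns the recursion on the first block into the recursion on
    the last one. *)
Lemma sweepmx_rev t : sweepmx (rev t) = (sweepmx t)^T.
Proof.
elim: t => [|i t IH] /=; first by rewrite trmx0.
rewrite rev_cons sweepmx_rcons IH linearD/= trmx_mul linearB/= trmx1 trmx_mul.
by rewrite B_sym S_psd.1.
Qed.

Lemma corrector_form i u :
  dotv (B i *m u) (S *m (B i *m u)) = dotv u (B i *m u).
Proof. by rewrite dotvC dotv_mulmxr B_sym !mulmxA B_idem dotvC. Qed.

Lemma corrector_psd i : psdmx (B i).
Proof. by split=> // u; rewrite -corrector_form; exact: psdmx_form_ge0. Qed.

(** Each solve adds <r, B i r> to 2 <v, w> - <w, S w>, where w is the current
    point and r = v - S w its residual.  If the total increase is zero then no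
    solve moves w away from 0, so the residual is v all along and every B i
    of the sweep annihilates it. *)
Lemma sweepmx_energy t v :
  0 <= 2 * dotv v (sweepmx t *m v)
       - dotv (sweepmx t *m v) (S *m (sweepmx t *m v)) /\
  (2 * dotv v (sweepmx t *m v)
     - dotv (sweepmx t *m v) (S *m (sweepmx t *m v)) = 0 ->
   sweepmx t *m v = 0 /\ forall i, i \in t -> B i *m v = 0).
Proof.
have ST := S_psd.1.
elim/last_ind: t => [|t i [IH1 IH2]].
  by rewrite /= mul0mx !dotv0l dotv0 mulr0 subr0.
set w := sweepmx t *m v in IH1 IH2 *.
have [r rE] : exists r, r = v - S *m w by exists (v - S *m w).
set z := B i *m r.
rewrite sweepmx_rcons_mul -/w -rE -/z.
have zSz : dotv z (S *m z) = dotv r z.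
  by rewrite corrector_form.
have -> : 2 * dotv v (w + z) - dotv (w + z) (S *m (w + z)) =
   2 * dotv v w - dotv w (S *m w) + dotv r z.
  have vz : dotv v z = dotv r z + dotv w (S *m z).
    by rewrite (form_sym _ _ ST) dotvC [dotv r z]dotvC rE !dotE subrK.
  by rewrite !(mulmxDr, dotE) zSz vz (form_sym z w ST); ring.
have rz0 : 0 <= dotv r z by exact: (corrector_psd i).2.
split=> [|E0]; first exact: addr_ge0.
have {IH2} [w0 tv0] := IH2 ltac:(lra).
have rv : r = v by rewrite rE w0 mulmx0 subr0.
have z0 : z = 0 by apply: (psdmx_isotropic (corrector_psd i)); lra.
split=> [|j]; first by rewrite w0 z0 addr0.
by rewrite mem_rcons inE => /predU1P[->|/tv0//]; rewrite -rv.
Qed.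

Lemma sweepmx_form_ge0 t v : 0 <= dotv v (sweepmx t *m v).
Proof.
have [h _] := sweepmx_energy t v.
have := psdmx_form_ge0 (sweepmx t *m v) S_psd; lra.
Qed.

Lemma sweepmx_form_eq0 t v : dotv v (sweepmx t *m v) = 0 ->
  forall i, i \in t -> B i *m v = 0.
Proof.
move=> h0; have [h h'] := sweepmx_energy t v.
have h2 := psdmx_form_ge0 (sweepmx t *m v) S_psd.
by apply: (h' _).2; lra.
Qed.

(** Left unnormalized, so that grouping the orders by their first block is an
    identity between sums. *)
Definition sweepsum s : 'M[R]_p := \sum_(t <- permutations s) sweepmx t.

(** Reversal permutes the orders. *)
Lemma sweepsum_sym s : (sweepsum s)^T = sweepsum s.
Proof.
rewrite /sweepsum linear_sum/=.
under eq_bigr do rewrite -sweepmx_rev.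
rewrite -(big_map rev predT sweepmx); apply: perm_big.
apply: uniq_perm; rewrite ?permutations_uniq//.
  by rewrite map_inj_uniq ?permutations_uniq//; exact: (can_inj revK).
move=> t; rewrite mem_permutations -{1}(revK t) mem_map ?mem_permutations.
  by rewrite perm_rev.
exact: (can_inj revK).
Qed.

Lemma sweepsum_rec s : (0 < size s)%N -> uniq s ->
  sweepsum s = \sum_(i <- s) (((size s).-1)`!%:R *: B i
     + sweepsum (rem i s) *m (1%:M - S *m B i)).
Proof.
move=> s0 us; rewrite /sweepsum (perm_big _ (permutationsE s0))/=.
rewrite big_allpairs_dep/= undup_id//; rewrite !big_seq; apply: eq_bigr => i si.
rewrite big_split/= mulmx_suml; congr (_ + _).
rewrite big_const_seq count_predT iter_addr_0 size_permutations ?rem_uniq//.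
by rewrite size_rem// scaler_nat.
Qed.

End Sweeps.

(** * The spectral bound on the averaged sweep *)

(** With <., .> the semi-inner product of S and E = 1 - Q S, the claim reads
    <E Pi x, x> > -1/3 <x, x> for the orthogonal projection Pi = 1 - B S.  Put
    F = E + 1/3, so that 0 <= F <= 4/3, and z = x - Pi x.  Then

      <E Pi x, x> + 1/3 <x, x> = <F x, x> - <F x, z> + 1/3 <z, z>,

    and after completing the square 1/3 |z - 3/2 F x|^2 there remains
    <F x, x> - 3/4 <F x, F x>, which is nonnegative, and positive unless
    <F x - 4/3 x, F x - 4/3 x> = 0.  Below, q = Q S x, and
    z - 3/2 F x = z - 2 x + 3/2 q. *)
Lemma sweep_step_bound (R : realType) (p : nat) (S B Q : 'M[R]_p) :
  psdmx S -> B^T = B -> B *m S *m B = B ->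
  psdmx Q ->
  (forall x, 0 < dotv x (S *m x) ->
     dotv (S *m x) (Q *m (S *m x)) < 4 / 3 * dotv x (S *m x)) ->
  forall x, 0 < dotv x (S *m x) ->
    dotv (S *m x) ((B + Q *m (1%:M - S *m B)) *m (S *m x))
      < 4 / 3 * dotv x (S *m x).
Proof.
move=> Spsd BT BSB Qpsd Qlt x x0; have ST := Spsd.1; have QT := Qpsd.1.
have [q qE] : exists q, q = Q *m (S *m x) by exists (Q *m (S *m x)).
have [z zE] : exists z, z = B *m (S *m x) by exists (B *m (S *m x)).
have S_swap u v : dotv (S *m u) v = dotv u (S *m v).
  by rewrite dotv_mulmxr ST.
have -> : (B + Q *m (1%:M - S *m B)) *m (S *m x) = z + (q - Q *m (S *m z)).
  by rewrite mulmxDl -mulmxA mulmxBl mul1mx mulmxBr -(mulmxA S) -zE -qE.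
have zz : dotv z (S *m z) = dotv x (S *m z).
  by rewrite dotvC {2}zE dotv_mulmxr BT zE mulmxA mulmxA BSB dotvC -S_swap.
have xQz : dotv (S *m x) (Q *m (S *m z)) = dotv q (S *m z).
  by rewrite dotv_mulmxr QT -qE.
rewrite !dotE xQz !S_swap.
have xz : dotv x (S *m z) <= dotv x (S *m x).
  have := psdmx_form_ge0 (x - z) Spsd.
  by rewrite !(mulmxBr, dotE) (form_sym z x ST) zz; lra.
have qq0 := psdmx_form_ge0 q Spsd.
(* If <q, q> = 0 then S q = 0: the terms with q disappear, and
   <x, z> <= <x, x> is enough. *)
have [qq|qq] : 0 = dotv q (S *m q) \/ 0 < dotv q (S *m q).
  by move: qq0; rewrite le_eqVlt => /predU1P[]; [left|right].
  have Sq : S *m q = 0 by apply: (psdmx_isotropic Spsd).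
  have := S_swap q z; rewrite Sq dotv0l dotv0; lra.
have xq : 3 / 4 * dotv q (S *m q) < dotv x (S *m q).
  have := psdmx_form_ge0 (S *m x - (3 / 4) *: (S *m q)) Qpsd.
  have xQq : dotv (S *m x) (Q *m (S *m q)) = dotv q (S *m q).
    by rewrite dotv_mulmxr QT -qE.
  rewrite !(mulmxBr, dotE) -!scalemxAr !dotE -qE xQq !S_swap.
  have := Qlt _ qq; rewrite S_swap; lra.
have := psdmx_form_ge0 (z - 2 *: x + (3 / 2) *: q) Spsd.
rewrite !(mulmxDr, mulmxN, dotE) -!scalemxAr !dotE zz.
rewrite (form_sym z x ST) (form_sym z q ST) (form_sym q x ST); lra.
Qed.

Section SweepAverage.
Context {R : realType} {p : nat} {I : eqType}.
Context {S : 'M[R]_p} {B : I -> 'M[R]_p}.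
Hypothesis S_psd : psdmx S.
Hypothesis B_sym : forall i, (B i)^T = B i.
Hypothesis B_idem : forall i, B i *m S *m B i = B i.
Hypothesis B_sep : forall v : 'cV[R]_p, (forall i, B i *m v = 0) -> v = 0.
Implicit Types (s t : seq I) (u v x : 'cV[R]_p).
Local Notation sweepsum := (@sweepsum R p I S B).

Lemma sweepsum_psd s : psdmx (sweepsum s).
Proof.
split; first exact: sweepsum_sym.
move=> u; rewrite /sweepsum mulmx_suml dotv_sumr sumr_ge0// => t _.
exact: sweepmx_form_ge0.
Qed.

(** The average over the orders of s is the mean, over the first block i, of a
    solve of i followed by the average over the orders of the other blocks. *)
Lemma sweepsum_bound s x : uniq s -> 0 < dotv x (S *m x) ->
  dotv (S *m x) (sweepsum s *m (S *m x))
    < 4 / 3 * (size s)`!%:R * dotv x (S *m x).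
Proof.
move sn : (size s) => k; elim: k s sn x => [|k IH] s sn x us x0.
  rewrite (size0nil sn) /sweepsum big_seq1/= mul0mx dotv0 fact0; lra.
rewrite sweepsum_rec ?sn// mulmx_suml dotv_sumr /= big_seq.
rewrite (@lt_le_trans _ _ (\sum_(i <- s | i \in s)
   (4 / 3 * k`!%:R * dotv x (S *m x))))//; last first.
  rewrite -big_seq big_const_seq count_predT iter_addr_0 sn factS natrM -mulr_natl.
  by rewrite le_eqVlt; apply/orP; left; apply/eqP; ring.
have k0 : 0 < k`!%:R :> R by rewrite ltr0n fact_gt0.
apply: ltr_sum => [|i si].
  by case: s sn us => //= i s _ _; rewrite inE eqxx.
have := @sweep_step_bound R p S (B i) (k`!%:R^-1 *: sweepsum (rem i s)) S_psd
  (B_sym i) (B_idem i).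
have [Qsym Qpos] := sweepsum_psd (rem i s).
move=> /(_ _ _ x x0) h.
have /h{}h : psdmx (k`!%:R^-1 *: sweepsum (rem i s)).
  split=> [|u]; first by rewrite linearZ/= Qsym.
  by rewrite -scalemxAl dotvZr mulr_ge0// invr_ge0 ltW.
have {}h := h _; rewrite -(ltr_pM2l k0) in h.
have := h _; rewrite -dotvZr scalemxAl scalerDr -scalemxAl scalerA.
rewrite divff ?gt_eqF// scale1r.
rewrite [X in _ < X](_ : _ = 4 / 3 * k`!%:R * dotv x (S *m x)); last by ring.
apply=> y y0; rewrite -scalemxAl dotvZr mulrC ltr_pdivrMr//.
rewrite mulrAC; apply: IH => //; last exact: rem_uniq.
by rewrite size_rem// sn.
Qed.

(** Every term is nonnegative, and the term of the order s alone is definite. *)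
Lemma sweepsum_pd s : (forall i, i \in s) -> pdmx (sweepsum s).
Proof.
move=> sI; split; first exact: sweepsum_sym.
move=> v v0; rewrite lt_def (sweepsum_psd s).2 andbT.
apply: contra_neq v0; rewrite /sweepsum mulmx_suml dotv_sumr.
rewrite (big_rem s) ?mem_permutations//= => /eqP.
rewrite paddr_eq0 ?sweepmx_form_ge0//; last first.
  by apply: sumr_ge0 => t _; exact: sweepmx_form_ge0.
move=> /andP[/eqP/(sweepmx_form_eq0 S_psd B_sym B_idem) h _].
by apply: B_sep => i; exact: h.
Qed.

End SweepAverage.

(** The form of Q is nonnegative at Q^-1 u - 3/4 S u, which says that
    <u, Q^-1 u> is at least 3/2 <u, S u> - 9/16 <S u, Q S u>. *)
Lemma pdmx_inv_subr (R : realType) (p : nat) (S Q : 'M[R]_p) :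
  psdmx S -> pdmx Q ->
  (forall x, 0 < dotv x (S *m x) ->
     dotv (S *m x) (Q *m (S *m x)) < 4 / 3 * dotv x (S *m x)) ->
  pdmx (invmx Q - (3 / 4) *: S).
Proof.
move=> Spsd Qpd Qlt; have [WT Wpos] := pdmx_inv Qpd; have Qu := pdmx_unit Qpd.
split; first by rewrite linearB/= linearZ/= WT Spsd.1.
move=> u u0; rewrite mulmxBl -scalemxAl !dotE.
have := psdmx_form_ge0 u Spsd; rewrite le_eqVlt => /predU1P[<-|Su].
  by rewrite mulr0 subr0 Wpos.
have := psdmx_form_ge0 (invmx Q *m u - (3 / 4) *: (S *m u)) (pdmx_psd Qpd).
rewrite mulmxBr mulKVmx// -scalemxAr !dotE [dotv _ (Q *m _)]dotv_mulmxr.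
rewrite Qpd.1 mulKVmx// !(dotvC _ u); have := Qlt u Su; lra.
Qed.

(** * Convergence of the averaged recursion *)

(** Expand V at x' = x + e and substitute W e = A^T mu - S x: the cross terms
    with mu cancel, and the increase of V becomes
    1/2 <x', S x'> + 1/2 <x, S x> - 2 <x', S x> - <e, W e> - <x', H x'>.  Taking
    3/4 <e, S e> out of <e, W e> turns the first three terms into
    - 1/4 <x + x', S (x + x')>. *)
Lemma padmm_lyapunov (R : realType) (p m : nat) (S W H : 'M[R]_p)
    (A : 'M[R]_(m, p)) (beta : R) (x x' : 'cV[R]_p) (mu mu' : 'cV[R]_m) :
  0 < beta -> W^T = W -> S^T = S -> S = H + beta *: (A^T *m A) ->
  W *m (x' - x) = A^T *m mu - S *m x -> mu' = mu - beta *: (A *m x') ->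
  let V y nu := dotv y (W *m y) - 2^-1 * dotv y (S *m y)
                + beta^-1 * dotv nu nu in
  V x' mu' = V x mu - (4^-1 * dotv (x + x') (S *m (x + x'))
    + dotv x' (H *m x')
    + dotv (x' - x) ((W - (3 / 4) *: S) *m (x' - x))).
Proof.
move=> b0 WT ST SE xE ->.
have [e eE] : exists e, e = x' - x by exists (x' - x).
move: xE; have {eE} -> : x' = x + e by rewrite eE addrC subrK.
have -> : x + e - x = e by rewrite addrC addKr.
move=> We.
have We' y : dotv y (W *m e) = dotv (A *m y) mu - dotv y (S *m x).
  by rewrite We !dotE dotv_mulmxr trmxK.
have S' y z : dotv y (S *m z) = dotv y (H *m z) + beta * dotv (A *m y) (A *m z).
  rewrite SE mulmxDl -scalemxAl -mulmxA !dotE.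
  by rewrite [dotv y (A^T *m _)]dotv_mulmxr trmxK.
have Hx y z : dotv y (H *m z) = dotv y (S *m z) - beta * dotv (A *m y) (A *m z).
  by rewrite S' addrK.
rewrite /= Hx !(mulmxDr, mulmxBl, dotE) -!scalemxAl.
rewrite !(mulmxDr, dotE) (form_sym e x WT) !We' (form_sym e x ST).
rewrite !(dotvC mu) (dotvC (A *m e) (A *m x)).
by field; rewrite gt_eqF.
Qed.

Lemma cvg_mx_coord (R : realType) (p q : nat) (u : nat -> 'M[R]_(p, q))
    (l : 'M[R]_(p, q)) :
  (forall i j, (fun k => u k i j) @ \oo --> l i j) -> u @ \oo --> l.
Proof.
move=> ul A [P Pl PA]; rewrite /= /nbhs/=.
near=> k; apply: PA => i j /=.
move: i j; near: k; apply: filter_forall => i; apply: filter_forall => j.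
exact: ul (Pl i j).
Unshelve. all: by end_near. Qed.

(** If N and N^2 have the same kernel then they have the same rank, hence the
    same range. *)
Lemma mulmx_absorb_range (R : realType) (p : nat) (N : 'M[R]_p) :
  (forall w : 'cV[R]_p, N *m (N *m w) = 0 -> N *m w = 0) ->
  forall z : 'cV[R]_p, exists w, N *m z = N *m (N *m w).
Proof.
move=> Nker z.
have /submxP[X NX] : (N^T <= N^T *m N^T)%MS.
  suff rk : \rank (N^T *m N^T) = \rank N^T.
    by have := mxrank_leqif_sup (submxMl N^T N^T); rewrite rk => /leqif_refl.
  rewrite -[RHS](mxrank_mul_ker N^T N^T) (_ : (N^T :&: kermx N^T)%MS = 0).
    by rewrite mxrank0 addn0.
  apply/eqP/rowV0P => v; rewrite sub_capmx => /andP[/submxP[w ->]].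
  move=> /sub_kermxP wNN; apply: trmx_inj.
  rewrite trmx_mul trmxK trmx0; apply: Nker; apply: trmx_inj.
  by rewrite !trmx_mul trmxK trmx0.
exists (X^T *m z); rewrite mulmxA mulmxA; congr (_ *m _).
by rewrite -[LHS]trmxK NX !trmx_mul trmxK.
Qed.

(** If v = (M - 1) w is fixed by M, then M shifts every point of the line
    w + R v by v.  At the point of that line that is V-orthogonal to v, the shift
    increases V by <v, V v>. *)
Lemma nonexpansive_ker_sqr (R : realType) (p : nat) (M V : 'M[R]_p) :
  pdmx V ->
  (forall z : 'cV[R]_p, dotv (M *m z) (V *m (M *m z)) <= dotv z (V *m z)) ->
  forall w : 'cV[R]_p, (M - 1%:M) *m ((M - 1%:M) *m w) = 0 -> (M - 1%:M) *m w = 0.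
Proof.
move=> [VT Vpos] Mle w; set v := (M - 1%:M) *m w.
have Mw : M *m w = w + v by rewrite /v mulmxBl mul1mx addrC subrK.
rewrite mulmxBl mul1mx => /eqP; rewrite subr_eq0 => /eqP Mv.
apply/eqP; apply: contraT => /Vpos v0; exfalso.
move: v Mw Mv v0 => v Mw Mv v0.
have := Mle (w - (dotv w (V *m v) / dotv v (V *m v)) *: v).
rewrite mulmxBr -scalemxAr Mw Mv.
rewrite !(mulmxDr, mulmxBr, mulmxN, dotE) -!scalemxAr !dotE (form_sym v w VT).
move: (dotv w (V *m w)) (dotv w (V *m v)) (dotv v (V *m v)) v0 => a b c c0.
rewrite -subr_ge0 leNgt; apply/negP; rewrite negbK.
rewrite [X in X < 0](_ : _ = - c) ?oppr_lt0//.
by field; rewrite gt_eqF.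
Qed.

(** D is the decrease of V.  It is summable along the orbits, hence tends to 0,
    and with it M^(k+1) w - M^k w for every w. *)
Lemma iter_mulmx_cvg (R : realType) (p : nat) (M V : 'M[R]_p)
    (D : 'cV[R]_p -> R) :
  pdmx V -> (forall z, 0 <= D z) ->
  (forall z : 'cV[R]_p, dotv (M *m z) (V *m (M *m z)) + D z <= dotv z (V *m z)) ->
  (forall l : 'cV[R]_p, exists C, 0 <= C /\
     forall z, dotv l ((M - 1%:M) *m z) ^+ 2 <= C * D z) ->
  forall z : 'cV[R]_p, exists2 f, M *m f = f & (fun k => iter k (mulmx M) z) @ \oo --> f.
Proof.
move=> Vpd D0 decr Dctl z.
have Mle y : dotv (M *m y) (V *m (M *m y)) <= dotv y (V *m y).
  by apply: le_trans (decr y); rewrite lerDl.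
have [w zw] := mulmx_absorb_range (nonexpansive_ker_sqr Vpd Mle) z.
set f := z - (M - 1%:M) *m w.
have Mf : M *m f = f.
  apply/eqP; rewrite -subr_eq0 -{2}(mul1mx f) -mulmxBl /f mulmxBr -zw.
  by rewrite subrr.
exists f => //.
pose W k := iter k (mulmx M) w.
have iterE k : iter k (mulmx M) z = f + (M - 1%:M) *m W k.
  elim: k => [|k IH]; first by rewrite /f /W subrK.
  rewrite iterS IH mulmxDr Mf /W iterS; congr (_ + _).
  by rewrite mulmxBl mulmxBr mul1mx mulmxBl mul1mx.
pose e k := dotv (W k) (V *m W k).
have eS k : e k.+1 + D (W k) <= e k by exact: decr.
have e_cvg : cvgn e.
  apply: nonincreasing_is_cvgn.
    by apply/nonincreasing_seqP => k; apply: le_trans (eS k); rewrite lerDl.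
  by exists 0 => _ [k _ <-]; exact/psdmx_form_ge0/pdmx_psd.
have DW : (fun k => D (W k)) @ \oo --> (0 : R).
  apply: (@squeeze_cvgr _ _ _ _ (fun=> 0) (fun k => e k - e k.+1)).
  - by near=> k; rewrite D0/=; have := eS k; lra.
  - exact: cvg_cst.
  - rewrite -(subrr (limn e)); apply: cvgB => //.
    by rewrite (cvg_shiftS e).
apply: cvg_mx_coord => i j; rewrite ord1.
under eq_fun do rewrite iterE mxE.
suff rest : (fun k => ((M - 1%:M) *m W k) i 0) @ \oo --> (0 : R).
  by have := cvgD (cvg_cst (f i 0)) rest; rewrite addr0; apply.
have [C [C0 CD]] := Dctl (delta_mx i 0).
apply/cvgr0Pnorm_lt => eps eps0.
have CDW : (fun k => C * D (W k)) @ \oo --> (0 : R).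
  by rewrite -(mulr0 C); apply: cvgM => //; exact: cvg_cst.
near=> k.
have : C * D (W k) < eps ^+ 2.
  by near: k; apply: (cvgr_lt _ CDW); rewrite exprn_gt0.
move=> /(le_lt_trans (CD (W k))); rewrite dotv_delta -[X in X < _]real_normK ?num_real//.
by rewrite ltr_pXn2r ?nnegrE// ltW.
Unshelve. all: by end_near. Qed.

Lemma dotv_col_mx (R : realType) (p q : nat) (a c : 'cV[R]_p) (b e : 'cV[R]_q) :
  dotv (col_mx a b) (col_mx c e) = dotv a c + dotv b e.
Proof. by rewrite /dotv tr_col_mx mul_row_col mxE. Qed.

Lemma pdmx_block_diag (R : realType) (p q : nat) (V1 : 'M[R]_p) (V2 : 'M[R]_q) :
  pdmx V1 -> pdmx V2 -> pdmx (block_mx V1 0 0 V2).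
Proof.
move=> V1pd V2pd; split; first by rewrite tr_block_mx !trmx0 V1pd.1 V2pd.1.
move=> z; rewrite -[z]vsubmxK; set a := usubmx z; set b := dsubmx z.
rewrite mul_block_col !mul0mx addr0 add0r dotv_col_mx => z0.
have [a0|/V1pd.2 a0] := eqVneq a 0; last first.
  by rewrite ltr_wpDr//; exact/psdmx_form_ge0/pdmx_psd.
have [b0|/V2pd.2 b0] := eqVneq b 0; first by rewrite a0 b0 col_mx0 eqxx in z0.
by rewrite ltr_wpDl//; exact/psdmx_form_ge0/pdmx_psd.
Qed.

(** One step is the linear map M on pairs (x, mu).  Its displacement is
    (e, - beta A x') with e = x' - x, and A x' is half of A (x + x') + A e, so
    both parts are controlled by the decrease of the Lyapunov function. *)
Lemma padmm_cvg (R : realType) (p m : nat) (H Q : 'M[R]_p) (A : 'M[R]_(m, p))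
    (beta : R) (S := H + beta *: (A^T *m A))
    (x : nat -> 'cV[R]_p) (mu : nat -> 'cV[R]_m) :
  0 < beta -> psdmx H -> pdmx Q ->
  (forall u, 0 < dotv u (S *m u) ->
     dotv (S *m u) (Q *m (S *m u)) < 4 / 3 * dotv u (S *m u)) ->
  (forall k, x k.+1 = x k - Q *m (S *m x k - A^T *m mu k)) ->
  (forall k, mu k.+1 = mu k - beta *: (A *m x k.+1)) ->
  exists xl mul, [/\ H *m xl = A^T *m mul, A *m xl = 0,
    x @ \oo --> xl & mu @ \oo --> mul].
Proof.
move=> b0 Hpsd Qpd Qlt xS muS.
have SE u : dotv u (S *m u) = dotv u (H *m u) + beta * dotv (A *m u) (A *m u).
  rewrite mulmxDl -scalemxAl -mulmxA !dotE; congr (_ + _ * _).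
  by rewrite dotv_mulmxr trmxK.
have Spsd : psdmx S.
  split; first by rewrite linearD/= linearZ/= trmx_mul trmxK Hpsd.1.
  by move=> u; rewrite SE addr_ge0 ?mulr_ge0 ?dotvv_ge0 ?(ltW b0)//; exact: Hpsd.2.
have Qu := pdmx_unit Qpd; have WT := (pdmx_inv Qpd).1.
have Gpd := pdmx_inv_subr Spsd Qpd Qlt.
pose W := invmx Q; pose G := W - (3 / 4) *: S.
pose nx (y : 'cV[R]_p) (nu : 'cV[R]_m) := y - Q *m (S *m y - A^T *m nu).
pose nmu (y : 'cV[R]_p) (nu : 'cV[R]_m) := nu - beta *: (A *m nx y nu).
pose M : 'M[R]_(p + m) :=
  block_mx (1%:M - Q *m S) (Q *m A^T)
    (- beta *: (A *m (1%:M - Q *m S))) (1%:M - beta *: (A *m (Q *m A^T))).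
have ME y nu : M *m col_mx y nu = col_mx (nx y nu) (nmu y nu).
  have nxE : nx y nu = (1%:M - Q *m S) *m y + (Q *m A^T) *m nu.
    by rewrite /nx mulmxBl mul1mx mulmxBr opprB addrA addrAC !mulmxA.
  rewrite mul_block_col -nxE /nmu nxE; congr col_mx.
  move: (1%:M - Q *m S) (Q *m A^T) => P1 P2.
  rewrite mulmxDr scalerDr opprD mulmxBl mul1mx -!scalemxAl scaleNr !mulmxA.
  by rewrite addrCA.
pose V : 'M[R]_(p + m) := block_mx (W - 2^-1 *: S) 0 0 (beta^-1%:M).
pose Dx (y y' : 'cV[R]_p) := 4^-1 * dotv (y + y') (S *m (y + y'))
  + dotv y' (H *m y') + dotv (y' - y) (G *m (y' - y)).
have VE y nu : dotv (col_mx y nu) (V *m col_mx y nu) =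
    dotv y (W *m y) - 2^-1 * dotv y (S *m y) + beta^-1 * dotv nu nu.
  rewrite mul_block_col !mul0mx addr0 add0r dotv_col_mx mul_scalar_mx dotvZr.
  by rewrite mulmxBl -scalemxAl !dotE.
pose D (z : 'cV[R]_(p + m)) := Dx (usubmx z) (nx (usubmx z) (dsubmx z)).
have DE y nu : D (col_mx y nu) = Dx y (nx y nu).
  by rewrite /D col_mxKu col_mxKd.
have Vpd : pdmx V.
  apply: pdmx_block_diag; last first.
    split=> [|u u0]; first by rewrite tr_scalar_mx.
    rewrite mul_scalar_mx dotvZr mulr_gt0 ?invr_gt0//.
    by have := (@pdmx_scalar1 R m).2 u u0; rewrite mul1mx.
  split=> [|u u0]; first by rewrite linearB/= linearZ/= WT Spsd.1.
  have := Gpd.2 u u0; have := psdmx_form_ge0 u Spsd.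
  by rewrite !mulmxBl -!scalemxAl !dotE /W; lra.
have D0 z : 0 <= D z.
  by rewrite !addr_ge0 ?mulr_ge0 ?invr_ge0 ?ler0n//; apply: psdmx_form_ge0 => //;
    exact: pdmx_psd.
have Vdecr z : dotv (M *m z) (V *m (M *m z)) + D z <= dotv z (V *m z).
  rewrite -[z]vsubmxK; set y := usubmx z; set nu := dsubmx z.
  rewrite ME !VE DE.
  rewrite (padmm_lyapunov b0 WT Spsd.1 (erefl S) (x := y) (mu := nu)) /Dx ?subrK//.
  by rewrite /nx addrAC subrr add0r mulmxN /W mulKmx// opprB.
have Dctl (l : 'cV[R]_(p + m)) : exists C, 0 <= C /\
     forall z, dotv l ((M - 1%:M) *m z) ^+ 2 <= C * D z.
  rewrite -[l]vsubmxK; set l1 := usubmx l; set l2 := dsubmx l.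
  have [C1 [C10 C1P]] := pdmx_dotv_bound (l1 - (beta / 2) *: (A^T *m l2)) Gpd.
  have [C2 [C20 C2P]] := pdmx_dotv_bound l2 (@pdmx_scalar1 R m).
  (* From (u - v)^2 <= 2 u^2 + 2 v^2 and beta |A s|^2 <= <s, S s>, s = x + x'. *)
  exists (2 * C1 + 2 * beta * C2); split.
    by rewrite addr_ge0 ?mulr_ge0// ltW.
  move=> z; rewrite -[z]vsubmxK; set y := usubmx z; set nu := dsubmx z.
  rewrite mulmxBl mul1mx ME DE opp_col_mx add_col_mx dotv_col_mx /nmu.
  have [y' y'E] : exists y', y' = nx y nu by exists (nx y nu).
  rewrite -y'E addrAC subrr add0r dotvNr dotvZr.
  have [e eE] : exists e, e = y' - y by exists (y' - y).
  have [s sE] : exists s, s = y + y' by exists (y + y').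
  have -> : dotv l1 (y' - y) - beta * dotv l2 (A *m y') =
      dotv (l1 - (beta / 2) *: (A^T *m l2)) e - beta / 2 * dotv l2 (A *m s).
    rewrite eE sE !(dotE, mulmxDr) !dotv_mulmxr.
    by field.
  rewrite /Dx -eE -sE.
  have := C1P e; have := C2P (A *m s); rewrite mul1mx.
  have := SE s; have := Hpsd.2 y'; have := Hpsd.2 s.
  have := psdmx_form_ge0 e (pdmx_psd Gpd); have := dotvv_ge0 (A *m s).
  rewrite -/W -/G.
  move: (dotv _ e) (dotv l2 _) (dotv (A *m s) _) (dotv s (S *m s))
    (dotv s (H *m s)) (dotv y' _) (dotv e _) => u t a sS sH h g.
  move=> a0 g0 sH0 h0 sSE tC uC.
  have c1 : 0 <= C1 * sS by rewrite sSE mulr_ge0// addr_ge0// mulr_ge0// ltW.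
  have c2 : 0 <= C1 * h by exact: mulr_ge0.
  have c3 : 0 <= beta * C2 * h by rewrite !mulr_ge0// ltW.
  have c4 : 0 <= beta * C2 * g by rewrite !mulr_ge0// ltW.
  have c5 : 0 <= beta * C2 * sH by rewrite !mulr_ge0// ltW.
  have c6 : beta ^+ 2 * t ^+ 2 <= beta ^+ 2 * (C2 * a) by rewrite ler_wpM2l// sqr_ge0.
  have c7 : 0 <= (u + beta / 2 * t) ^+ 2 by exact: sqr_ge0.
  rewrite sSE in c1 *.
  have -> : (2 * C1 + 2 * beta * C2) * (4^-1 * (sH + beta * a) + h + g) =
    C1 * (sH + beta * a) / 2 + 2 * (C1 * h) + 2 * (C1 * g)
    + (beta * C2 * sH) / 2 + beta ^+ 2 * (C2 * a) / 2 + 2 * (beta * C2 * h)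
    + 2 * (beta * C2 * g) by field.
  have -> : (u - beta / 2 * t) ^+ 2 =
    2 * u ^+ 2 + beta ^+ 2 * t ^+ 2 / 2 - (u + beta / 2 * t) ^+ 2 by field.
  lra.
pose z0 := col_mx (x 0) (mu 0).
have [f Mf zf] := iter_mulmx_cvg Vpd D0 Vdecr Dctl z0.
have zE k : iter k (mulmx M) z0 = col_mx (x k) (mu k).
  elim: k => [//|k IH]; rewrite iterS IH ME.
  by rewrite muS xS.
have := Mf; rewrite -[f]vsubmxK ME => /eq_col_mx[fx fmu].
exists (usubmx f), (dsubmx f).
have Af : A *m usubmx f = 0.
  move: fmu; rewrite /nmu fx => /eqP; rewrite eq_sym -subr_eq0 opprB addrC subrK.
  by rewrite scaler_eq0 gt_eqF//= => /eqP.
have Sf : S *m usubmx f = A^T *m dsubmx f.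
  move: fx; rewrite /nx => /eqP; rewrite eq_sym -subr_eq0 opprB addrC subrK.
  move=> /eqP /(congr1 (mulmx W)); rewrite mulKmx// mulmx0 => /eqP.
  by rewrite subr_eq0 => /eqP.
have coord i : (fun k => col_mx (x k) (mu k) i 0) @ \oo --> f i 0.
  rewrite (_ : (fun k => _) = (fun N : 'cV[R]_(p + m) => N i 0)
    \o (fun k => iter k (mulmx M) z0)); last by apply/funext => k /=; rewrite zE.
  by apply: cvg_comp; [exact: zf|exact: coord_continuous].
split => //.
- by rewrite -Sf mulmxDl -scalemxAl -mulmxA Af mulmx0 scaler0 addr0.
- apply: cvg_mx_coord => i j; rewrite ord1 mxE.
  have := coord (lshift m i).
  by under eq_fun do rewrite col_mxEu.
- apply: cvg_mx_coord => i j; rewrite ord1 mxE.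
  have := coord (rshift p i).
  by under eq_fun do rewrite col_mxEd.
Qed.

(** * One step of the method *)

Section Blocks.
Context {R : realType} {n : nat} {d : 'I_n -> nat}.
Local Notation dim := (\sum_(i < n) d i)%N.

Definition blockproj (i : 'I_n) : 'M[R]_(d i, dim) := submxcol 1%:M i.

Lemma blockprojE q (z : 'M[R]_(dim, q)) i : blockproj i *m z = submxcol z i.
Proof. by rewrite /blockproj submxcol_mul mul1mx. Qed.

Lemma mul_trblockproj q (M : 'M[R]_(q, dim)) i :
  M *m (blockproj i)^T = submxrow M i.
Proof. by apply: trmx_inj; rewrite trmx_mul trmxK blockprojE tr_submxrow. Qed.

Lemma blockproj_conj (M : 'M[R]_dim) i j :
  blockproj i *m M *m (blockproj j)^T = submxblock M i j.
Proof. by rewrite blockprojE mul_trblockproj submxblockEv. Qed.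

Lemma blockproj_orthogonal i j : i != j ->
  blockproj i *m (blockproj j)^T = 0.
Proof.
move=> /negbTE ij; rewrite -[blockproj i]mulmx1 blockproj_conj -mxdiagZ mxblockK.
by rewrite ij.
Qed.

Lemma sum_blockproj : \sum_i (blockproj i)^T *m blockproj i = 1%:M.
Proof.
rewrite -mul_mxrow_mxcol submxcolK mulmx1; apply: trmx_inj.
rewrite tr_mxrow trmx1 -[RHS]submxcolK; apply: eq_mxcol => i.
by rewrite trmxK.
Qed.

Lemma block_support (z : 'cV[R]_dim) i :
  (forall l, l != i -> submxcol z l = 0) -> z = (blockproj i)^T *m submxcol z i.
Proof.
move=> z0; rewrite -[LHS]mul1mx -sum_blockproj mulmx_suml [LHS](bigD1 i)//=.
rewrite -mulmxA blockprojE [X in _ + X]big1 ?addr0// => l li.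
by rewrite -mulmxA blockprojE z0// mulmx0.
Qed.

Lemma submxcol_ext (y z : 'cV[R]_dim) :
  (forall i, submxcol y i = submxcol z i) -> y = z.
Proof. by move=> yz; rewrite -[y]submxcolK -[z]submxcolK; exact: eq_mxcol. Qed.

Lemma blockproj_form (M : 'M[R]_dim) i (u : 'cV[R]_(d i)) :
  dotv ((blockproj i)^T *m u) (M *m ((blockproj i)^T *m u)) =
  dotv u (submxblock M i i *m u).
Proof. by rewrite -blockproj_conj -2!mulmxA [RHS]dotv_mulmxr. Qed.

Lemma pdmx_submxblock (M : 'M[R]_dim) i : pdmx M -> pdmx (submxblock M i i).
Proof.
move=> [MT Mpos]; split=> [|u u0]; first by rewrite tr_submxblock MT.
rewrite -blockproj_form; apply: Mpos; apply: contra_neq u0 => Pu.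
have := congr1 (mulmx (blockproj i)) Pu; rewrite mulmx0 mulmxA.
rewrite -{1}[blockproj i]mulmx1 blockproj_conj -mxdiagZ submxblock_diag.
by rewrite mul1mx.
Qed.

End Blocks.

Section BlockStep.
Context {R : realType} {n : nat} {d : 'I_n -> nat}.
Local Notation dim := (\sum_(i < n) d i)%N.
Context {S : 'M[R]_dim}.
Hypothesis S_block_pd : forall i, pdmx (submxblock S i i).
Local Notation blockproj := (@blockproj R n d).

Definition blocksolve (i : 'I_n) : 'M[R]_dim :=
  (blockproj i)^T *m invmx (submxblock S i i) *m blockproj i.

Lemma blocksolve_sym i : (blocksolve i)^T = blocksolve i.
Proof.
by rewrite /blocksolve !trmx_mul trmxK mulmxA (pdmx_inv (S_block_pd i)).1.
Qed.

Lemma blocksolve_embed i :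
  blocksolve i *m S *m (blockproj i)^T = (blockproj i)^T.
Proof.
rewrite /blocksolve -!mulmxA [blockproj i *m _]mulmxA blockproj_conj.
by rewrite mulVmx ?mulmx1//; exact: pdmx_unit.
Qed.

Lemma blocksolve_idem i : blocksolve i *m S *m blocksolve i = blocksolve i.
Proof.
by rewrite {2}/blocksolve !mulmxA blocksolve_embed.
Qed.

Lemma blocksolve_eq0 i (v : 'cV[R]_dim) : blocksolve i *m v = 0 -> submxcol v i = 0.
Proof.
move=> Bv; apply/eqP; apply: contraT => /(pdmx_inv (S_block_pd i)).2.
rewrite -blockprojE.
have -> : dotv (blockproj i *m v)
   (invmx (submxblock S i i) *m (blockproj i *m v)) = dotv v (blocksolve i *m v).
  by rewrite /blocksolve -!mulmxA [RHS]dotv_mulmxr trmxK.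
by rewrite Bv dotv0 ltxx.
Qed.

Lemma blocksolve_sep (v : 'cV[R]_dim) : (forall i, blocksolve i *m v = 0) -> v = 0.
Proof.
move=> Bv; apply: submxcol_ext => i; rewrite submxcol0.
exact/blocksolve_eq0/Bv.
Qed.

End BlockStep.

Section ADMMStep.
Context {R : realType} {n m : nat} {d : 'I_n -> nat}.
Local Notation dim := (\sum_(i < n) d i)%N.
Context {H : 'M[R]_dim} {g : 'cV[R]_dim}.
Context {A : forall i : 'I_n, 'M[R]_(m, d i)} {b : 'cV[R]_m} {beta : R}.
Local Notation At := (\mxrow_i A i).
Local Notation S := (H + beta *: (At^T *m At)).
Local Notation B := (@blocksolve R n d S).
Hypothesis H_psd : psdmx H.
Hypothesis beta_gt0 : 0 < beta.
Hypothesis diag_pd :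
  pdmx (\mxdiag_i submxblock H i i + \mxdiag_i ((A i)^T *m A i)).

Lemma residualE z : residual A b z = At *m z - b.
Proof. by rewrite /residual -mul_mxrow_mxcol submxcolK. Qed.

Lemma augmented_psd : psdmx S.
Proof.
split; first by rewrite linearD/= linearZ/= trmx_mul trmxK H_psd.1.
move=> u; rewrite mulmxDl -scalemxAl !dotE -mulmxA [dotv u (At^T *m _)]dotv_mulmxr.
by rewrite trmxK addr_ge0 ?mulr_ge0 ?dotvv_ge0 ?(ltW beta_gt0)//; exact: H_psd.2.
Qed.

(** The hypothesis on the blocks has weight 1 on A_i^T A_i instead of beta:
    at each nonzero vector one of the two forms is positive. *)
Lemma augmented_block_pd i : pdmx (submxblock S i i).
Proof.
have AP : At *m (blockproj i)^T = A i by rewrite mul_trblockproj mxrowK.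
have := pdmx_submxblock i diag_pd; rewrite -mxdiagD submxblock_diag => -[_ Fpos].
split=> [|u u0]; first by rewrite tr_submxblock augmented_psd.1.
have := Fpos u u0; rewrite !mulmxDl !dotE -!mulmxA [dotv u ((A i)^T *m _)]dotv_mulmxr.
rewrite trmxK -!blockproj_form mulmxDl -scalemxAl !dotE -[At^T *m At *m _]mulmxA.
rewrite [dotv _ (At^T *m _)]dotv_mulmxr trmxK (mulmxA At) AP.
have := H_psd.2 ((blockproj i)^T *m u).
rewrite le_eqVlt => /predU1P[<-|h0 _]; first by rewrite !add0r => /(mulr_gt0 beta_gt0).
by rewrite ltr_pwDl// mulr_ge0 ?dotvv_ge0// ltW.
Qed.

Lemma lagrangianD z h mu :
  lagrangian H g A b beta (z + h) mu = lagrangian H g A b beta z mu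
    + dotv h (S *m z + (g - At^T *m (mu + beta *: b)))
    + 2^-1 * dotv h (S *m h).
Proof.
rewrite /lagrangian !residualE mulmxDr.
rewrite !mulmxDl -!scalemxAl -!mulmxA !(mulmxDr, dotE).
rewrite -!scalemxAr !dotE.
rewrite ![dotv _ (At^T *m _)]dotv_mulmxr trmxK (form_sym z h H_psd.1).
rewrite !(dotvC mu) (dotvC (At *m z) (At *m h)) !(dotvC g) (dotvC b (At *m h)).
by field.
Qed.

(** Moving z by - B i r, with r the gradient at z, changes the Lagrangian by
    - <r, B i r> / 2, which the minimality of z forces to be 0. *)
Lemma block_minimizer_stationary mu i z :
  block_minimizer (fun z => lagrangian H g A b beta z mu) i z ->
  B i *m (S *m z + (g - At^T *m (mu + beta *: b))) = 0.
Proof.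
move=> zmin.
have [r rE] : exists r, r = S *m z + (g - At^T *m (mu + beta *: b)) by eexists.
have Bsym := blocksolve_sym augmented_block_pd.
have Bidem := blocksolve_idem augmented_block_pd.
have Bpsd := corrector_psd augmented_psd Bsym Bidem i.
rewrite -rE; apply: (psdmx_isotropic Bpsd).
have := zmin (z - B i *m r); rewrite lagrangianD -rE mulmxN 2!dotvNl dotvNr opprK.
rewrite (corrector_form Bsym Bidem) (dotvC _ r) => h.
have := Bpsd.2 r.
suff agree l : l != i -> submxcol (z - B i *m r) l = submxcol z l.
  by have := h agree; lra.
move=> li; rewrite submxcolB -[submxcol (_ *m _) _]blockprojE /blocksolve !mulmxA.
by rewrite blockproj_orthogonal// !mul0mx subr0.
Qed.

(** In particular the step determines its result.  After k blocks the error is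
    obtained from the initial one by the sweep over the first k blocks. *)
Lemma admm_step_affine (s : 'S_n) x mu x' mu' xh muh :
  admm_step H g A b beta s x mu x' mu' -> is_kkt H g A b xh muh ->
  x' - xh = (x - xh)
    - sweepmx (S := S) (B := B) [seq s j | j <- enum 'I_n]
        *m (S *m (x - xh) - At^T *m (mu - muh)) /\
  mu' - muh = (mu - muh) - beta *: (At *m (x' - xh)).
Proof.
move=> [xmin ->] [kkt1 kkt2]; split; last first.
  by rewrite residualE mulmxBr kkt2 addrAC.
set t := map _ _; set r := S *m (x - xh) - _.
have tsz : size t = n by rewrite size_map size_enum_ord.
pose Z k : 'cV[R]_dim :=
  \mxcol_i (if ((s^-1)%g i < k)%N then submxcol x' i else submxcol x i).
have Zn : Z n = x'.
  by apply: submxcol_ext => i; rewrite mxcolK ltn_ord.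
have SE z : S *m z + (g - At^T *m (mu + beta *: b)) =
    S *m (z - xh) - At^T *m (mu - muh).
  have cE : S *m xh + (g - At^T *m (mu + beta *: b)) = - (At^T *m (mu - muh)).
    rewrite mulmxDl -scalemxAl -mulmxA kkt2 !mulmxDr -scalemxAr mulmxN opprB opprD.
    rewrite -kkt1; apply/matrixP => i j; rewrite !mxE; ring.
  by rewrite -cE mulmxBr subrKA.
suff partial k : (k <= n)%N ->
    Z k - xh = (x - xh) - sweepmx (S := S) (B := B) (take k t) *m r.
  by rewrite -[in LHS]Zn partial// take_oversize// tsz.
elim: k => [_|k IH kn].
  rewrite take0 /= mul0mx subr0; congr (_ - _).
  by apply: submxcol_ext => i; rewrite mxcolK.
pose j := Ordinal kn.
have sj : s j = nth (s j) t k.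
  by rewrite (nth_map j) ?size_enum_ord// (nth_ord_enum j j).
have ZS : block_minimizer (fun z => lagrangian H g A b beta z mu) (s j) (Z k.+1).
  by have := xmin j; congr block_minimizer; apply: submxcol_ext => i;
    rewrite !mxcolK ltnS.
have dZ : Z k.+1 - Z k = (blockproj (s j))^T *m submxcol (Z k.+1 - Z k) (s j).
  apply: block_support => l lsj; rewrite submxcolB !mxcolK ltnS leq_eqVlt.
  suff /negbTE-> : ((s^-1)%g l : nat) != k by rewrite subrr.
  apply: contra lsj => /eqP lk.
  by rewrite -[l](permKV s) (_ : (s^-1)%g l = j)//; exact: val_inj.
(* The update moves block s j only, and on such vectors B (s j) inverts S. *)
have BdZ : B (s j) *m (S *m (Z k.+1 - Z k)) = Z k.+1 - Z k.
  by rewrite dZ !mulmxA (blocksolve_embed augmented_block_pd).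
have := block_minimizer_stationary ZS; rewrite SE.
have -> : Z k.+1 - xh = (Z k.+1 - Z k) + (Z k - xh) by rewrite subrKA.
rewrite (mulmxDr S) -addrA (mulmxDr (B (s j))) BdZ => /eqP; rewrite addr_eq0 => /eqP ->.
rewrite (take_nth (s j)) ?tsz// -sj sweepmx_rcons_mul (IH (ltnW kn)).
move: (sweepmx _ *m r) => w.
rewrite [LHS]addrC [in RHS]opprD [RHS]addrA; congr (_ - _ *m _).
by rewrite (mulmxBr S) addrAC.
Qed.

End ADMMStep.

(** * Expectations over finitely many permutations *)

Section FiniteExpectation.
Context {R : realType} {disp : measure_display} {T : measurableType disp}.
Context {P : probability T R} {Z : finType} {h : T -> Z}.
Hypothesis h_meas : forall z, measurable (h @^-1` [set z]).

Lemma expectation_finite (f : Z -> R) :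
  fine 'E_P[fun w => f (h w)]%E = \sum_z fine (P (h @^-1` [set z])) * f z.
Proof.
have indic_int z : P.-integrable setT (EFin \o \1_(h @^-1` [set z])).
  by apply: integrable_indic.
have pE z : P (h @^-1` [set z]) = (fine (P (h @^-1` [set z])))%:E.
  by rewrite fineK// fin_num_measure.
rewrite unlock.
under eq_integral => w _.
  have -> : (f (h w))%:E =
      (\sum_z (f z)%:E * (\1_(h @^-1` [set z]) w)%:E)%E.
    rewrite (bigD1 (h w))//= indicE mem_set//= mule1 big1 ?adde0// => z zw.
    by rewrite indicE memNset ?mule0//= => hwz; rewrite hwz eqxx in zw.
  over.
rewrite integral_sum//; last by move=> z; apply: integrableZl; [|exact: indic_int].
under eq_bigr => z _.
  rewrite integralZl//; last exact: indic_int.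
  rewrite integral_indic// setIT [X in (_ * X)%E]pE -EFinM mulrC.
  over.
by rewrite sumEFin.
Qed.

Lemma expectation_cV_finite p (X : Z -> 'cV[R]_p) :
  expectation_cV P (fun w => X (h w)) =
  \sum_z fine (P (h @^-1` [set z])) *: X z.
Proof.
apply/matrixP => i j; rewrite ord1 mxE summxE.
rewrite (expectation_finite (fun z => X z i 0)).
by apply: eq_bigr => z _; rewrite mxE.
Qed.

Lemma expectation_cVB p (X Y : Z -> 'cV[R]_p) :
  expectation_cV P (fun w => X (h w) - Y (h w)) =
  expectation_cV P (fun w => X (h w)) - expectation_cV P (fun w => Y (h w)).
Proof.
rewrite (expectation_cV_finite (fun z => X z - Y z)) !expectation_cV_finite.
by rewrite -sumrB; apply: eq_bigr => z _; rewrite scalerBr.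
Qed.

Lemma expectation_cV_mulmx p q (M : 'M[R]_(q, p)) (X : Z -> 'cV[R]_p) :
  expectation_cV P (fun w => M *m X (h w)) =
  M *m expectation_cV P (fun w => X (h w)).
Proof.
rewrite (expectation_cV_finite (fun z => M *m X z)) expectation_cV_finite.
by rewrite mulmx_sumr; apply: eq_bigr => z _; rewrite scalemxAr.
Qed.

End FiniteExpectation.

Lemma expectation_cV_cst (R : realType) (disp : measure_display)
    (T : measurableType disp) (P : probability T R) p (c : 'cV[R]_p) :
  expectation_cV P (fun=> c) = c.
Proof.
by apply/matrixP => i j; rewrite ord1 mxE (expectation_cst P (c i 0)).
Qed.

(** The first k draws as an element of a finite type: the state after k steps is
    a function of it, so that expectations become finite sums. *)
Definition history (T U : Type) (sigma : nat -> T -> U) k (w : T) : k.-tuple U :=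
  [tuple of mkseq (sigma^~ w) k].

Section History.
Context {R : realType} {n : nat} {disp : measure_display}.
Context {T : measurableType disp} {P : probability T R}.
Context {sigma : nat -> T -> 'S_n}.
Hypothesis sigma_iid : iid_uniform_perms P sigma.

Lemma history_preimage k (t : k.-tuple 'S_n) :
  history sigma k @^-1` [set t] =
  \bigcap_(i in [set` [fset i in iota 0 k]%fset])
     (sigma i @^-1` [set nth 1%g t i]).
Proof.
apply/seteqP; split => w /=.
  move=> wt i /=; rewrite !inE mem_iota add0n /= => ik.
  by rewrite -wt /= nth_mkseq.
move=> wt; apply: val_inj; apply: (@eq_from_nth _ 1%g).
  by rewrite size_mkseq size_tuple.
move=> i; rewrite size_mkseq => ik; rewrite nth_mkseq//.
by apply: wt; rewrite /= !inE mem_iota.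
Qed.

Lemma measurable_history k (t : k.-tuple 'S_n) :
  measurable (history sigma k @^-1` [set t]).
Proof.
rewrite history_preimage; apply: bigcap_measurableType => i _.
by have [sm _ _] := sigma_iid; exact: sm.
Qed.

Lemma history_next k (t : k.-tuple 'S_n) (s : 'S_n) :
  P ((history sigma k @^-1` [set t]) `&` (sigma k @^-1` [set s])) =
  (P (history sigma k @^-1` [set t]) * ((n`!%:R : R)^-1)%:E)%E.
Proof.
have [_ unif indep] := sigma_iid.
pose J := [fset i in iota 0 k]%fset.
have kJ : k \notin J by rewrite !inE mem_iota add0n ltnn andbF.
pose C i : set 'S_n := if i == k then [set s] else [set nth 1%g t i].
have CE i : i \in J -> C i = [set nth 1%g t i].
  by move=> iJ; rewrite /C; case: eqP => // ik; move: iJ; rewrite ik (negbTE kJ).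
have -> : (history sigma k @^-1` [set t]) `&` (sigma k @^-1` [set s]) =
    \bigcap_(i in [set` (k |` J)%fset]) (sigma i @^-1` C i).
  rewrite history_preimage; apply/seteqP; split=> w.
    move=> [wt ws] i /=; rewrite in_fset1U => /predU1P[->|iJ].
      by rewrite /C eqxx.
    by rewrite CE//; exact: wt.
  move=> wC; split=> [i iJ|].
    by rewrite -CE//; apply: wC; rewrite /= in_fset1U iJ orbT.
  by have := wC k; rewrite /C eqxx; apply; rewrite /= in_fset1U eqxx.
rewrite indep big_fsetU1//= {1}/C eqxx unif muleC; congr (_ * _)%E.
rewrite -indep history_preimage; congr (P _).
by apply: eq_bigcapr => i iJ; rewrite CE.
Qed.

(** The next permutation can be averaged out first, since it is uniform and
    independent of the earlier ones. *)
Lemma expectation_cV_next p k (F : 'S_n -> k.-tuple 'S_n -> 'cV[R]_p) :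
  expectation_cV P (fun w => F (sigma k w) (history sigma k w)) =
  (n`!%:R)^-1 *: \sum_s expectation_cV P (fun w => F s (history sigma k w)).
Proof.
pose h w := (sigma k w, history sigma k w).
have hE s t : h @^-1` [set (s, t)] =
    (history sigma k @^-1` [set t]) `&` (sigma k @^-1` [set s]).
  by apply/seteqP; split=> w /=; [case=> -> ->|case=> wt ws; rewrite /h wt ws].
have mh z : measurable (h @^-1` [set z]).
  case: z => s t; rewrite hE; apply: measurableI; first exact: measurable_history.
  by have [sm _ _] := sigma_iid; exact: sm.
rewrite (expectation_cV_finite mh (fun z => F z.1 z.2)) /=.
transitivity ((n`!%:R)^-1 *:
    \sum_s \sum_t fine (P (history sigma k @^-1` [set t])) *: F s t); last first.
  congr (_ *: _); apply: eq_bigr => s _.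
  by rewrite (expectation_cV_finite (@measurable_history k) (F s)).
rewrite pair_bigA scaler_sumr; apply: eq_bigr => -[s t] _ /=.
rewrite hE history_next fineM ?fin_num_measure//=; last exact: measurable_history.
by rewrite scalerA mulrC.
Qed.

End History.

(** * Expected convergence *)

(** Distinct permutations give distinct orders, and there are n! of each. *)
Lemma sum_perm_words (V : nmodType) n (f : seq 'I_n -> V) :
  \sum_(s : 'S_n) f [seq s j | j <- enum 'I_n] =
  \sum_(t <- permutations (enum 'I_n)) f t.
Proof.
rewrite -(big_map (fun s : 'S_n => [seq s j | j <- enum 'I_n]) predT f).
apply: perm_big; set W := map _ _.
have uW : uniq W.
  rewrite map_inj_uniq ?index_enum_uniq// => s1 s2 /eq_in_map s12.
  by apply/permP => j; apply: s12; rewrite mem_enum.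
have subW : {subset W <= permutations (enum 'I_n)}.
  move=> _ /mapP[s _ ->]; rewrite mem_permutations; apply: uniq_perm.
  - by rewrite map_inj_uniq ?enum_uniq//; exact: perm_inj.
  - exact: enum_uniq.
  - move=> i; rewrite mem_enum; apply/mapP; exists (s^-1%g i).
      by rewrite mem_enum.
    by rewrite permKV.
apply: uniq_perm => //; first exact: permutations_uniq.
have [|//] := uniq_min_size uW subW.
rewrite size_permutations ?enum_uniq// size_enum_ord size_map.
rewrite -(card_Sn n) -sum1_card -sum1_size; apply: eq_leq; exact: eq_bigl.
Qed.

Theorem theorem3 (R : realType) (n m : nat) (d : 'I_n -> nat)
    (H : 'M[R]_(\sum_(i < n) d i)%N) (g : 'cV[R]_(\sum_(i < n) d i)%N)
    (A : forall i : 'I_n, 'M[R]_(m, d i)) (b : 'cV[R]_m)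
    (H_psd : psdmx H)
    (kkt_nonempty : exists x mu, is_kkt H g A b x mu)
    (diag_pd : pdmx (\mxdiag_i submxblock H i i + \mxdiag_i ((A i)^T *m A i)))
    (beta : R) (beta_gt0 : 0 < beta)
    (disp : measure_display) (T : measurableType disp) (P : probability T R)
    (sigma : nat -> T -> 'S_n) (sigma_iid : iid_uniform_perms P sigma)
    (x0 : 'cV[R]_(\sum_(i < n) d i)%N) (mu0 : 'cV[R]_m)
    (x : nat -> T -> 'cV[R]_(\sum_(i < n) d i)%N) (mu : nat -> T -> 'cV[R]_m)
    (run : rpadmm_run H g A b sigma beta x0 mu0 x mu) :
  exists (xbar : 'cV[R]_(\sum_(i < n) d i)%N) (mubar : 'cV[R]_m),
    is_kkt H g A b xbar mubar /\
    (fun k : nat => (expectation_cV P (x k), expectation_cV P (mu k)))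
      @ \oo --> (xbar, mubar).
Proof.
have [xh [muh kkt]] := kkt_nonempty.
pose At := \mxrow_i A i.
pose S := H + beta *: (At^T *m At).
pose B := @blocksolve R n d S.
have S_psd : psdmx S := augmented_psd H_psd beta_gt0.
have S_pd : forall i, pdmx (submxblock S i i) :=
  augmented_block_pd H_psd beta_gt0 diag_pd.
have Bsym : forall i, (B i)^T = B i := blocksolve_sym S_pd.
have Bidem : forall i, B i *m S *m B i = B i := blocksolve_idem S_pd.
pose K (s : 'S_n) := sweepmx (S := S) (B := B) [seq s j | j <- enum 'I_n].
pose Q := (n`!%:R)^-1 *: sweepsum (S := S) (B := B) (enum 'I_n).
have n0 : 0 < n`!%:R^-1 :> R by rewrite invr_gt0 ltr0n fact_gt0.
have QE : Q = n`!%:R^-1 *: \sum_s K s.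
  by rewrite /Q /sweepsum (sum_perm_words (sweepmx (S := S) (B := B))).
have Qpd : pdmx Q.
  have [|QT Qpos] := sweepsum_pd S_psd Bsym Bidem (blocksolve_sep S_pd)
    (s := enum 'I_n); first by move=> i; rewrite mem_enum.
  split=> [|u /Qpos u0]; first by rewrite linearZ/= QT.
  by rewrite -scalemxAl dotvZr mulr_gt0.
have Qlt u : 0 < dotv u (S *m u) ->
    dotv (S *m u) (Q *m (S *m u)) < 4 / 3 * dotv u (S *m u).
  move=> u0; rewrite -scalemxAl dotvZr mulrC ltr_pdivrMr ?ltr0n ?fact_gt0//.
  have := sweepsum_bound S_psd Bsym Bidem (enum_uniq 'I_n) u0.
  by rewrite size_enum_ord mulrAC.
pose step (z : 'cV[R]_(\sum_(i < n) d i)%N * 'cV[R]_m) (s : 'S_n) :=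
  let y := z.1 - K s *m (S *m z.1 - At^T *m z.2) in
  (y, z.2 - (beta *: At) *m y).
pose Phi := foldl step (x0 - xh, mu0 - muh).
have PhiS k w :
    Phi (history sigma k.+1 w) = step (Phi (history sigma k w)) (sigma k w).
  rewrite -[RHS]foldl_rcons; congr foldl; exact: mkseqS.
(* The errors at step k depend on the randomness through the first k draws. *)
have xPhi k w : (x k w - xh, mu k w - muh) = Phi (history sigma k w).
  elim: k => [|k IH]; first by have [-> [-> _]] := run w.
  rewrite PhiS -IH; have [_ [_ /(_ k)]] := run w.
  move=> /(admm_step_affine H_psd beta_gt0 diag_pd)/(_ kkt)[-> ->].
  by rewrite /step /= -scalemxAl.
have mh k := measurable_history sigma_iid (k := k).
pose Ey k := expectation_cV P (fun w => (Phi (history sigma k w)).1).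
pose Enu k := expectation_cV P (fun w => (Phi (history sigma k w)).2).
have nK (V : lmodType R) (v : V) : n`!%:R^-1 *: \sum_(s : 'S_n) v = v.
  by rewrite sumr_const card_Sn -[v *+ _]scaler_nat scalerA mulVf ?scale1r//.
have EyF k s : expectation_cV P (fun w => (step (Phi (history sigma k w)) s).1) =
    Ey k - K s *m (S *m Ey k - At^T *m Enu k).
  rewrite (expectation_cVB (mh k) (fun t => (Phi t).1)
    (fun t => K s *m (S *m (Phi t).1 - At^T *m (Phi t).2))).
  rewrite (expectation_cV_mulmx (mh k) (K s)
    (fun t => (S *m (Phi t).1 - At^T *m (Phi t).2))).
  rewrite (expectation_cVB (mh k) (fun t => S *m (Phi t).1)
    (fun t => At^T *m (Phi t).2)).
  rewrite (expectation_cV_mulmx (mh k) S (fun t => (Phi t).1)).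
  by rewrite (expectation_cV_mulmx (mh k) At^T (fun t => (Phi t).2)).
have EyE k : Ey k.+1 =
    n`!%:R^-1 *: \sum_s expectation_cV P (fun w => (step (Phi (history sigma k w)) s).1).
  rewrite -(expectation_cV_next sigma_iid (fun s t => (step (Phi t) s).1)).
  by congr expectation_cV; apply/funext => w; rewrite PhiS.
have EyS k : Ey k.+1 = Ey k - Q *m (S *m Ey k - At^T *m Enu k).
  rewrite EyE (eq_bigr _ (fun s _ => EyF k s)) sumrB scalerBr nK.
  by rewrite -mulmx_suml scalemxAl -QE.
have EnuS k : Enu k.+1 = Enu k - beta *: (At *m Ey k.+1).
  transitivity (expectation_cV P
    (fun w => (step (Phi (history sigma k w)) (sigma k w)).2)).
    by congr expectation_cV; apply/funext => w; rewrite PhiS.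
  rewrite (expectation_cV_next sigma_iid (fun s t => (step (Phi t) s).2)).
  rewrite EyE scalemxAl -[LHS]/(_ *: _) -scalemxAr mulmx_sumr.
  rewrite -[X in X - _](nK _ (Enu k)) -scalerBr -sumrB; congr (_ *: _).
  apply: eq_bigr => s _.
  rewrite (expectation_cVB (mh k) (fun t => (Phi t).2)
    (fun t => (beta *: At) *m (step (Phi t) s).1)).
  by rewrite (expectation_cV_mulmx (mh k) _ (fun t => (step (Phi t) s).1)).
have [yl [nul [Hyl Ayl ycvg nucvg]]] := padmm_cvg beta_gt0 H_psd Qpd Qlt EyS EnuS.
exists (yl + xh), (nul + muh); split.
  have [k1 k2] := kkt; split; last by rewrite mulmxDr Ayl add0r.
  by rewrite !mulmxDr -k1 -Hyl addrA.
have xE k : expectation_cV P (x k) = Ey k + xh.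
  transitivity (expectation_cV P (fun w => (Phi (history sigma k w)).1 - - xh)).
    by congr expectation_cV; apply/funext => w; rewrite -xPhi /= opprK subrK.
  rewrite (expectation_cVB (mh k) (fun t => (Phi t).1) (fun=> - xh)).
  by rewrite expectation_cV_cst opprK.
have muE k : expectation_cV P (mu k) = Enu k + muh.
  transitivity (expectation_cV P (fun w => (Phi (history sigma k w)).2 - - muh)).
    by congr expectation_cV; apply/funext => w; rewrite -xPhi /= opprK subrK.
  rewrite (expectation_cVB (mh k) (fun t => (Phi t).2) (fun=> - muh)).
  by rewrite expectation_cV_cst opprK.
rewrite (_ : (fun k => _) = (fun k => (Ey k + xh, Enu k + muh))); last first.
  by apply/funext => k; rewrite xE muE.
have xcvg : (fun k => Ey k + xh) @ \oo --> yl + xh.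
  by apply: cvgD => //; exact: cvg_cst.
have mucvg : (fun k => Enu k + muh) @ \oo --> nul + muh.
  by apply: cvgD => //; exact: cvg_cst.
exact: (cvg_pair xcvg mucvg).
Qed.
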